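(* Let $(X,d)$ be a metric space. (i) If $(X,d)$ is unbounded and Gromov hyperbolic then $C(X,d)=1$. (ii) If $(X,d)$ has at least two points then it is $0$-hyperbolic if and only if $C_0(X,d)=1$.
   Context: For a metric space $(X,d)$ and $\mu,\delta \geq 0$, say that $(X,d)$ satisfies the $(\mu,\delta)$-four-point inequality if for all $x,y,z,w\in X$, $d(x,y)+d(z,w)\le \mu\max\{d(x,z)+d(y,w),\ d(x,w)+d(y,z)\}+2\delta$. The quasi-hyperbolicity constant of $(X,d)$ is $C(X,d)=\inf\{\mu\geq 0\mid \text{there exists }\delta\geq 0\text{ such that }(X,d)\text{ satisfies the }(\mu,\delta)\text{-four-point inequality}\}$, and the quadrilateral constant is $C_0(X,d)=\inf\{\mu\geq 0 \mid (X,d)\text{ satisfies the }(\mu,0)\text{-four-point inequality}\}$. $(X,d)$ is $\delta$-hyperbolic if it satisfies the $(1,\delta)$-four-point inequality, and Gromov hyperbolic if it is $\delta$-hyperbolic for some $\delta\geq 0$. *)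

(* Defs.v *)
From HB Require Import structures.
From mathcomp Require Import all_boot all_order all_algebra.
From mathcomp Require Import all_classical all_reals all_analysis.

Set Implicit Arguments.
Unset Strict Implicit.
Unset Printing Implicit Defensive.

Import Order.TTheory GRing.Theory Num.Theory.

Local Open Scope classical_set_scope.
Local Open Scope ring_scope.

Definition four_point (R : realType) (X : metricType R) (mu delta : R) : Prop :=
  forall x y z w : X,
    mdist x y + mdist z w <=
      mu * Num.max (mdist x z + mdist y w) (mdist x w + mdist y z) + 2 * delta.

(* [inf] on [R] has a default value on sets that are empty or not bounded below.
   That case does not occur in the next two definitions: by the triangle
   inequality every metric space satisfies the (2,0)-four-point inequality, so
   both sets contain 2, and 0 is a lower bound. *)
Definition quasi_hyperbolicity_constant (R : realType) (X : metricType R) : R :=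
  inf [set mu : R | 0 <= mu /\
                    exists delta : R, 0 <= delta /\ four_point X mu delta].

Definition quadrilateral_constant (R : realType) (X : metricType R) : R :=
  inf [set mu : R | 0 <= mu /\ four_point X mu 0].

Definition delta_hyperbolic (R : realType) (X : metricType R) (delta : R) : Prop :=
  four_point X 1 delta.

Definition gromov_hyperbolic (R : realType) (X : metricType R) : Prop :=
  exists delta : R, 0 <= delta /\ delta_hyperbolic X delta.

Definition unbounded_space (R : realType) (X : metricType R) : Prop :=
  ~ exists M : R, forall x y : X, mdist x y <= M.

(* Main.v *)
Require Import Defs.
From mathcomp Require Import all_boot all_order all_algebra.
From mathcomp Require Import all_classical all_reals all_analysis.
From mathcomp Require Import lra.

(** Both constants are infima of sets of admissible factors [mu], and three
    facts about these sets give the proposition.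

    - A factor [mu < 1] is admissible only in bounded spaces: for a degenerate
      quadruple [x, y, x, x] both sides of the four-point inequality only
      involve [mdist x y], and it reads [(1 - mu) * mdist x y <= 2 * delta]
      ([four_point_mdist_le]). With [delta = 0] this even forces
      [mdist x y = 0]. Hence [1] is a lower bound for the factors of an
      unbounded space, and for the factors with [delta = 0] of a space with two
      points.
    - Gromov hyperbolicity, resp. [0]-hyperbolicity, says that the factor [1] is
      admissible; [1] is then the least element of the set, hence its infimum.
    - Conversely, the infimum defining the quadrilateral constant is always
      attained ([four_point_quadrilateral_constant]), so that a space whose
      quadrilateral constant is [1] is [0]-hyperbolic. *)

Import Order.TTheory GRing.Theory Num.Theory.
Local Open Scope classical_set_scope.
Local Open Scope ring_scope.

Lemma inf_least (R : realType) (S : set R) (a : R) :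
  S a -> lbound S a -> inf S = a.
Proof.
move=> Sa lba; apply/eqP; rewrite eq_le; apply/andP; split.
  by apply: ge_inf => //; exists a.
by apply: lb_le_inf => //; exists a.
Qed.

Section FourPoint.
Context {R : realType} {X : metricType R}.
Implicit Types (mu delta : R) (x y z w : X).

(** The four-point inequality for the degenerate quadruple [x, y, x, x]. *)
Lemma four_point_mdist_le mu delta x y :
  four_point X mu delta -> (1 - mu) * mdist x y <= 2 * delta.
Proof.
move=> /(_ x y x x); rewrite mdistxx (metric_sym y x) addr0 add0r maxxx.
lra.
Qed.

Lemma four_point_unbounded_ge1 mu delta :
  unbounded_space X -> four_point X mu delta -> 1 <= mu.
Proof.
move=> unbX fpX; rewrite leNgt; apply/negP => mu_lt1.
apply: unbX; exists (2 * delta / (1 - mu)) => x y.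
by rewrite ler_pdivlMr ?subr_gt0// mulrC four_point_mdist_le.
Qed.

Lemma four_point0_ge1 mu x y : x <> y -> four_point X mu 0 -> 1 <= mu.
Proof.
move=> /eqP; rewrite -mdist_gt0 => xy_gt0 /(four_point_mdist_le _ _ x y).
by rewrite mulr0 pmulr_lle0// subr_le0.
Qed.

(** Going from [x] to [y] through [z] and through [w], and from [z] to [w]
    through [x] and through [y], bounds twice the left-hand side by twice the
    sum of the two terms of the maximum. *)
Lemma four_point_2_0 : four_point X 2 0.
Proof.
move=> x y z w.
have xzy := metric_triangle x z y; have xwy := metric_triangle x w y.
have zxw := metric_triangle z x w; have zyw := metric_triangle z y w.
rewrite (metric_sym z y) in xzy zyw; rewrite (metric_sym w y) in xwy.
rewrite (metric_sym z x) in zxw.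
set M := Num.max _ _.
have M1 : mdist x z + mdist y w <= M by rewrite le_max lexx.
have M2 : mdist x w + mdist y z <= M by rewrite le_max lexx orbT.
lra.
Qed.

(** For [delta = 0] the four-point inequality at a fixed quadruple is a closed
    condition on [mu]: either the maximum [M] is positive and the condition is
    [s / M <= mu], where [s] is the left-hand side, or [M = 0] and then [s = 0]
    because some factor is admissible. *)
Lemma four_point_quadrilateral_constant :
  four_point X (quadrilateral_constant X) 0.
Proof.
move=> x y z w; rewrite mulr0 addr0.
have := four_point_2_0 x y z w; rewrite mulr0 addr0.
set M := Num.max _ _ => s_le.
have M_ge0 : 0 <= M by rewrite le_max addr_ge0 ?mdist_ge0.
have [M_gt0|M_le0] := ltP 0 M.
  rewrite -ler_pdivrMr//; apply: lb_le_inf.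
    by exists 2; split; [exact: ler0n | exact: four_point_2_0].
  move=> mu [_ /(_ x y z w)]; rewrite mulr0 addr0.
  by rewrite -/M -ler_pdivrMr.
have M0 : M = 0 by apply/eqP; rewrite eq_le M_le0.
by move: s_le; rewrite M0 !mulr0.
Qed.

End FourPoint.

Theorem proposition2p6 (R : realType) (X : metricType R) :
  (unbounded_space X -> gromov_hyperbolic X ->
     quasi_hyperbolicity_constant X = 1) /\
  ((exists x y : X, x <> y) ->
     (delta_hyperbolic X 0 <-> quadrilateral_constant X = 1)).
Proof.
split=> [unbX hypX | [x [y xy]]].
  apply: inf_least; first by split.
  by move=> mu [_ [delta [_ fpX]]]; exact: four_point_unbounded_ge1 fpX.
split=> [hypX | C0_1].
  apply: inf_least; first by split.
  by move=> mu [_ fpX]; exact: four_point0_ge1 xy fpX.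
by rewrite /delta_hyperbolic -C0_1; exact: four_point_quadrilateral_constant.
Qed.
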